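(* Let $C\subset\mathbb{R}^d$ be a convex body that is lattice reduced with respect to a $d$-dimensional lattice $\Lambda$, and let $k$ be the dimension of the linear span of the set of width directions $y\in\Lambda^\star$ of $C$. Then $C$ is a polytope with at most $2^{k+1}-2$ vertices.
   Context: A convex body is a compact convex set with non-empty interior. A lattice $\Lambda\subset\mathbb{R}^d$ is a discrete subgroup spanning $\mathbb{R}^d$; $\Lambda^\star=\{y: x\cdot y\in\mathbb{Z}\ \forall x\in\Lambda\}$. The lattice width is $\mathrm{wdt}_\Lambda(C)=\min_{y\in\Lambda^\star\setminus\{0\}}\max_{a,b\in C}y\cdot(a-b)$; a width direction is a $y\in\Lambda^\star\setminus\{0\}$ attaining this minimum. $C$ is lattice reduced if no convex body $C'\subsetneq C$ has $\mathrm{wdt}_\Lambda(C')=\mathrm{wdt}_\Lambda(C)$. *)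

(* Defs.v *)
From HB Require Import structures.
From mathcomp Require Import all_boot all_order all_algebra.
From mathcomp Require Import all_classical all_reals all_analysis.
Set Implicit Arguments. Unset Strict Implicit. Unset Printing Implicit Defensive.
Import Order.TTheory GRing.Theory Num.Theory.
Import numFieldNormedType.Exports.
Local Open Scope classical_set_scope.
Local Open Scope ring_scope.

Section Defs.
Variables (R : realType) (d : nat).
Implicit Types (x y : 'rV[R]_d) (S C L : set 'rV[R]_d).

Definition dotv x y : R := \sum_(i < d) x 0 i * y 0 i.

Definition span_of S (U : {vspace 'rV[R]_d}) : Prop :=
  (forall x, S x -> x \in U) /\
  (forall V : {vspace 'rV[R]_d}, (forall x, S x -> x \in V) -> (U <= V)%VS).

Definition is_lattice L : Prop :=
  [/\ L 0,
      (forall x y, L x -> L y -> L (x - y)),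
      (forall x, L x -> exists2 e : R, 0 < e &
          forall y, L y -> ball x e y -> y = x) &
      (forall V : {vspace 'rV[R]_d}, (forall x, L x -> x \in V) -> V = fullv)].

Definition dual_lattice L : set 'rV[R]_d :=
  [set y | forall x, L x -> dotv x y \is a Num.int].

Definition convex_set C : Prop :=
  forall a b (t : R), C a -> C b -> 0 <= t -> t <= 1 ->
    C ((1 - t) *: a + t *: b).

Definition convex_body C : Prop :=
  [/\ convex_set C, compact C & C^° !=set0].

Definition width_along C y : R :=
  sup [set r | exists a b, [/\ C a, C b & r = dotv y (a - b)]].

Definition lattice_width L C : R :=
  inf [set r | exists y, [/\ dual_lattice L y, y != 0 & r = width_along C y]].

Definition width_direction L C : set 'rV[R]_d :=
  [set y | [/\ dual_lattice L y, y != 0 & width_along C y = lattice_width L C]].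

Definition lattice_reduced L C : Prop :=
  forall C', convex_body C' -> C' `<=` C -> C' <> C ->
    lattice_width L C' <> lattice_width L C.

Definition conv_seq (s : seq 'rV[R]_d) : set 'rV[R]_d :=
  [set x | exists l : 'I_(size s) -> R,
     [/\ forall i, 0 <= l i, \sum_i l i = 1 &
         x = \sum_i l i *: s`_i]].

Definition polytope_at_most C (n : nat) : Prop :=
  exists s : seq 'rV[R]_d, (size s <= n)%N /\ C = conv_seq s.

End Defs.

(* Main.v *)
(* Every exposed point p of C is the only maximizer of some width direction:
   otherwise a small cap at p could be cut off without decreasing the lattice
   width, because only finitely many dual vectors matter. There are finitely many
   width directions, so by Straszewicz's argument C is the convex hull of the
   finite set of these unique maximizers. To count them, consider two width
   directions y and z in the same class modulo 2 of the dual lattice, with y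
   maximized only at p. If y <> z and y <> - z, then (y + z) / 2 and (y - z) / 2
   are nonzero dual vectors of width at most that of C; as neither can have
   smaller width, z would be both maximal and minimal at p. A width direction is
   not twice a dual vector either. Hence each of the at most 2 ^ k - 1 nonzero
   classes of the group generated by the width directions contributes at most two
   vertices. *)

Require Import Defs.
From HB Require Import structures.
From mathcomp Require Import all_boot all_order all_algebra.
From mathcomp Require Import all_classical all_reals all_analysis.
From mathcomp Require Import zify ring lra.
Set Implicit Arguments. Unset Strict Implicit. Unset Printing Implicit Defensive.
Import Order.TTheory GRing.Theory Num.Theory.
Import numFieldNormedType.Exports.
Local Open Scope classical_set_scope.
Local Open Scope ring_scope.

(** * The dot product: bilinearity, continuity and extrema on compact sets *)

Section DotProduct.
Variables (R : realType) (d : nat).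
Implicit Types (x y z : 'rV[R]_d) (C : set 'rV[R]_d).

Lemma dotvC x y : dotv x y = dotv y x.
Proof. by apply: eq_bigr => i _; rewrite mulrC. Qed.

Lemma dotvDr x y z : dotv x (y + z) = dotv x y + dotv x z.
Proof.
by rewrite /dotv -big_split; apply: eq_bigr => i _; rewrite mxE mulrDr.
Qed.

Lemma dotvZr x (a : R) y : dotv x (a *: y) = a * dotv x y.
Proof.
by rewrite /dotv mulr_sumr; apply: eq_bigr => i _; rewrite mxE mulrCA.
Qed.

Lemma dotvNr x y : dotv x (- y) = - dotv x y.
Proof. by rewrite -scaleN1r dotvZr mulN1r. Qed.

Lemma dotvBr x y z : dotv x (y - z) = dotv x y - dotv x z.
Proof. by rewrite dotvDr dotvNr. Qed.

Lemma dotvDl x y z : dotv (x + y) z = dotv x z + dotv y z.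
Proof. by rewrite !(dotvC _ z) dotvDr. Qed.

Lemma dotvZl (a : R) x y : dotv (a *: x) y = a * dotv x y.
Proof. by rewrite !(dotvC _ y) dotvZr. Qed.

Lemma dotvNl x y : dotv (- x) y = - dotv x y.
Proof. by rewrite !(dotvC _ y) dotvNr. Qed.

Lemma dotvBl x y z : dotv (x - y) z = dotv x z - dotv y z.
Proof. by rewrite dotvDl dotvNl. Qed.

Lemma dot0v x : dotv 0 x = 0.
Proof. by rewrite -(scale0r x) dotvZl mul0r. Qed.

Lemma dotv_sumr (I : Type) (r : seq I) (P : pred I) (F : I -> 'rV[R]_d) x :
  dotv x (\sum_(i <- r | P i) F i) = \sum_(i <- r | P i) dotv x (F i).
Proof.
apply: (big_morph (dotv x)) => [y z|]; first exact: dotvDr.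
by rewrite dotvC dot0v.
Qed.

Lemma dotv_suml (I : Type) (r : seq I) (P : pred I) (F : I -> 'rV[R]_d) x :
  dotv (\sum_(i <- r | P i) F i) x = \sum_(i <- r | P i) dotv (F i) x.
Proof. by rewrite dotvC dotv_sumr; apply: eq_bigr => i _; rewrite dotvC. Qed.

Lemma dotv_delta x i : dotv x (delta_mx 0 i) = x 0 i.
Proof.
rewrite /dotv (bigD1 i) //= big1 ?addr0 => [|j /negPf ji].
  by rewrite mxE !eqxx mulr1.
by rewrite mxE ji andbF mulr0.
Qed.

Lemma dotvv_ge0 x : 0 <= dotv x x.
Proof. by apply: sumr_ge0 => i _; rewrite -expr2 sqr_ge0. Qed.

Lemma dotvv_eq0 x : (dotv x x == 0) = (x == 0).
Proof.
apply/idP/eqP => [|->]; last by rewrite dot0v.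
rewrite psumr_eq0 => [/allP x0|i _]; last by rewrite -expr2 sqr_ge0.
apply/rowP => i; rewrite mxE; apply/eqP.
by have := x0 i (mem_index_enum i); rewrite -expr2 expf_eq0 => /andP[].
Qed.

Lemma dotvv_gt0 x : (0 < dotv x x) = (x != 0).
Proof. by rewrite lt_def dotvv_ge0 dotvv_eq0 andbT. Qed.

Lemma continuous_sumr (T : topologicalType) (I : Type) (r : seq I)
    (F : I -> T -> R) : (forall i, continuous (F i)) ->
  continuous (fun t : T => \sum_(i <- r) F i t).
Proof.
move=> cF t; elim: r => [|i r IH].
  by under eq_fun do rewrite big_nil; exact: cvg_cst.
under eq_fun do rewrite big_cons.
apply: cvgD => //; exact: cF.
Qed.

Lemma dotv_continuous y : continuous (dotv y).
Proof.
apply: continuous_sumr => i x.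
by apply: continuousM; [exact: cst_continuous|exact: coord_continuous].
Qed.

Lemma sqdist_continuous z : continuous (fun x => dotv (x - z) (x - z)).
Proof.
apply: continuous_sumr => i x.
have h : {for x, continuous (fun t : 'rV[R]_d => (t - z) 0 i)}.
  rewrite (_ : (fun t => _) = (fun t : 'rV[R]_d => t 0 i - z 0 i)).
    by apply: continuousB; [exact: coord_continuous|exact: cst_continuous].
  by apply/funext => t; rewrite !mxE.
exact: continuousM.
Qed.

Lemma compact_argmax C (f : 'rV[R]_d -> R) : compact C -> C !=set0 ->
  continuous f -> exists2 a, C a & forall b, C b -> f b <= f a.
Proof.
move=> cC C0 cf.
have [a aC am] := EVT_max_rV C0 cC (continuous_subspaceT cf).
by exists a => [|b Cb]; [rewrite -in_setE|apply: am; rewrite in_setE].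
Qed.

Lemma compact_argmin C (f : 'rV[R]_d -> R) : compact C -> C !=set0 ->
  continuous f -> exists2 a, C a & forall b, C b -> f a <= f b.
Proof.
move=> cC C0 cf.
have [a aC am] := EVT_min_rV C0 cC (continuous_subspaceT cf).
by exists a => [|b Cb]; [rewrite -in_setE|apply: am; rewrite in_setE].
Qed.

End DotProduct.

(** * Width of a compact set along a vector *)

Section Width.
Variables (R : realType) (d : nat).
Implicit Types (x y z : 'rV[R]_d) (C L : set 'rV[R]_d).

Lemma width_attained C y : compact C -> C !=set0 ->
  exists a b, [/\ C a, C b & width_along C y = dotv y (a - b)].
Proof.
move=> cC C0.
have [a Ca am] := compact_argmax cC C0 (@dotv_continuous _ _ y).
have [b Cb bm] := compact_argmax cC C0 (@dotv_continuous _ _ (- y)).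
exists a, b; split => //; apply/eqP; rewrite eq_le; apply/andP; split.
  apply: ge_sup; first by exists (dotv y (a - b)), a, b.
  move=> _ [a' [b' [Ca' Cb' ->]]].
  by have := am _ Ca'; have := bm _ Cb'; rewrite !dotvNl !dotvBr; lra.
apply: ub_le_sup; last by exists a, b.
exists (dotv y (a - b)) => _ [a' [b' [Ca' Cb' ->]]].
by have := am _ Ca'; have := bm _ Cb'; rewrite !dotvNl !dotvBr; lra.
Qed.

Lemma le_width C y a b : compact C -> C a -> C b ->
  dotv y (a - b) <= width_along C y.
Proof.
move=> cC Ca Cb; have C0 : C !=set0 by exists a.
have [a1 Ca1 am] := compact_argmax cC C0 (@dotv_continuous _ _ y).
have [b1 Cb1 bm] := compact_argmax cC C0 (@dotv_continuous _ _ (- y)).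
apply: ub_le_sup; last by exists a, b.
exists (dotv y (a1 - b1)) => _ [a' [b' [Ca' Cb' ->]]].
by have := am _ Ca'; have := bm _ Cb'; rewrite !dotvNl !dotvBr; lra.
Qed.

Lemma width_ge0 C y : compact C -> C !=set0 -> 0 <= width_along C y.
Proof.
move=> cC [a Ca]; apply: le_trans (le_width y cC Ca Ca).
by rewrite dotvBr subrr.
Qed.

Lemma width_mono C C' y : compact C -> compact C' -> C' !=set0 ->
  C' `<=` C -> width_along C' y <= width_along C y.
Proof.
move=> cC cC' C'0 C'C.
have [a [b [Ca Cb ->]]] := width_attained y cC' C'0.
by apply: le_width => //; exact: C'C.
Qed.

Lemma width_opp C y : compact C -> C !=set0 ->
  width_along C (- y) = width_along C y.
Proof.
move=> cC C0; apply/eqP; rewrite eq_le; apply/andP; split.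
  have [a [b [Ca Cb ->]]] := width_attained (- y) cC C0.
  by rewrite dotvNl -dotvNr opprB; exact: le_width.
have [a [b [Ca Cb ->]]] := width_attained y cC C0.
by rewrite -opprB dotvNr -dotvNl; exact: le_width.
Qed.

Lemma ball_delta x (e r : R) i : 0 < e -> `|r| < e ->
  ball x e (x + r *: delta_mx 0 i).
Proof.
move=> e0 re; split=> // j k; rewrite -ball_normE /ball_ /= !mxE.
rewrite opprD addrA subrr sub0r normrN normrM.
by case: (_ && _); rewrite ?normr1 ?mulr1 // normr0 mulr0.
Qed.

(** Moving from [x] by [e / 2] both ways along the [i]-th axis stays in the ball and gives two
    points of [C] at distance [e]. *)
Lemma width_ge_coord C x (e : R) y i : compact C -> 0 < e ->
  ball x e `<=` C -> e * `|y 0 i| <= width_along C y.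
Proof.
move=> cC e0 xeC.
have he : `|e / 2| < e by rewrite gtr0_norm; lra.
have Cp : C (x + (e / 2) *: delta_mx 0 i) by apply/xeC/ball_delta.
have Cm : C (x + (- (e / 2)) *: delta_mx 0 i).
  by apply/xeC/ball_delta; rewrite ?normrN.
have := le_width y cC Cp Cm; have := le_width y cC Cm Cp.
rewrite !dotvBr !dotvDr !dotvZr dotv_delta.
by case: ger0P => _; lra.
Qed.

Lemma lattice_width_le C L y : compact C -> C !=set0 -> dual_lattice L y ->
  y != 0 -> lattice_width L C <= width_along C y.
Proof.
move=> cC C0 Ly y0; apply: ge_inf; last by exists y.
by exists 0 => _ [z [_ _ ->]]; exact: width_ge0.
Qed.

End Width.

(** * The dual lattice and the finiteness of its bounded parts *)

Section DualLattice.
Variables (R : realType) (d : nat) (L : set 'rV[R]_d).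
Local Notation M := (dual_lattice L).
Implicit Types (x y z : 'rV[R]_d).

Lemma dual0 : M 0.
Proof. by move=> x _; rewrite dotvC dot0v rpred0. Qed.

Lemma dualD y z : M y -> M z -> M (y + z).
Proof. by move=> My Mz x Lx; rewrite dotvDr rpredD ?My ?Mz. Qed.

Lemma dualN y : M y -> M (- y).
Proof. by move=> My x Lx; rewrite dotvNr rpredN My. Qed.

Lemma dualZ (c : int) y : M y -> M (c%:~R *: y).
Proof. by move=> My x Lx; rewrite dotvZr rpredM ?My ?rpred_int. Qed.

Lemma dual_sum (I : Type) (r : seq I) (P : pred I) (F : I -> 'rV[R]_d) :
  (forall i, P i -> M (F i)) -> M (\sum_(i <- r | P i) F i).
Proof.
move=> MF; elim/big_ind : _ => //; [exact: dual0|exact: dualD].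
Qed.

Hypothesis fullL :
  forall V : {vspace 'rV[R]_d}, (forall x, L x -> x \in V) -> V = fullv.

(** Otherwise a lattice vector outside the current span could always be adjoined, and the dimension
    would grow without bound. *)
Lemma spanning_seq :
  exists2 X : seq 'rV[R]_d, (forall x, x \in X -> L x) & <<X>>%VS = fullv.
Proof.
apply: contrapT => noX.
have grow n : exists2 X : seq 'rV[R]_d,
    (forall x, x \in X -> L x) & (n <= \dim <<X>>)%N.
  elim: n => [|n [X XL nX]]; first by exists [::].
  have [x Lx xX] : exists2 x, L x & x \notin <<X>>%VS.
    apply: contrapT => nx; apply: noX; exists X => //; apply: fullL => x Lx.
    by apply: contrapT => /negP xX; apply: nx; exists x.
  exists (x :: X) => [z|].
    by rewrite inE => /predU1P[->//|/XL].
  apply: (leq_ltn_trans nX); rewrite ltn_neqAle.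
  have sX : (<<X>> <= <<x :: X>>)%VS by rewrite span_cons addvSr.
  rewrite dimvS // andbT (dimv_leqif_eq sX).
  apply: contra xX => /eqP ->; by rewrite memv_span ?inE ?eqxx.
have [X _] := grow (\dim {: 'rV[R]_d}).+1.
by rewrite ltnNge dimvS ?subvf.
Qed.

Lemma dotv_span_eq0 (X : seq 'rV[R]_d) y : <<X>>%VS = fullv ->
  (forall x, x \in X -> dotv y x = 0) -> y = 0.
Proof.
move=> Xf yX; apply/eqP; rewrite -dotvv_eq0; apply/eqP.
have : y \in <<in_tuple X>>%VS by rewrite Xf memvf.
move/coord_span => {2}->; rewrite dotv_sumr big1 // => i _.
by rewrite dotvZr yX ?mulr0 ?mem_nth.
Qed.

(** A dual vector is determined by its integer pairings with a finite spanning family of lattice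
    vectors, and bounded coordinates bound these pairings. *)
Lemma dual_bounded_finite (B : R) :
  finite_set [set y | M y /\ forall i, `|y 0 i| <= B].
Proof.
have [X XL Xf] := spanning_seq.
set A := [set y | _].
pose K : R := \sum_(j < size X) \sum_(i < d) `|B| * `|X`_j 0 i|.
pose N := Num.bound K.
have K0 : 0 <= K.
  by apply: sumr_ge0 => j _; apply: sumr_ge0 => i _; rewrite mulr_ge0.
have yK y (j : 'I_(size X)) : A y -> `|dotv y X`_j| <= N%:R.
  move=> [_ yB]; apply: le_trans (ltW (archi_boundP K0)).
  rewrite /K (bigD1 j) //= ler_wpDr //.
    by apply: sumr_ge0 => ? _; apply: sumr_ge0 => i _; rewrite mulr_ge0.
  apply: le_trans (ler_norm_sum _ _ _) _; apply: ler_sum => i _.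
  by rewrite normrM ler_wpM2r // (le_trans (yB i)) ?ler_norm.
(* The pairings of [y] with [X] are integers between [- N] and [N], so after a shift by [N] they fit
   in ['I_(N + N).+1] and [inord] loses nothing. *)
pose f y : {ffun 'I_(size X) -> 'I_(N + N).+1} :=
  [ffun j : 'I_(size X) => inord `|(Num.floor (dotv y X`_j) + N%:Z)%R|%N].
have f_inj y z : A y -> A z -> f y = f z -> y = z.
  move=> Ay Az fyz; apply/eqP; rewrite -subr_eq0; apply/eqP.
  apply: (dotv_span_eq0 Xf) => x xX.
  have xi : (index x X < size X)%N by rewrite index_mem.
  have fE t : A t -> dotv t x = (f t (Ordinal xi))%:R - N%:R.
    move=> At; have := yK t (Ordinal xi) At; rewrite ffunE /= nth_index //.
    have cint : (Num.floor (dotv t x))%:~R = dotv t x.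
      by apply/eqP; rewrite -intrEfloor dotvC; apply: At.1; exact: XL.
    move: (Num.floor _) cint => c <-.
    rewrite -intr_norm -[N%:R]/(N%:Z%:~R) ler_int ler_norml => /andP[cN cN'].
    rewrite inordK; last by lia.
    by rewrite natr_absz ger0_norm ?rmorphD /=; [ring|lia].
  by rewrite dotvBl !fE // fyz subrr.
(* [g] inverts [f] on [A]; the default [0] only serves codes that come from no vector of [A]. *)
pose g phi := xget (0 : 'rV[R]_d) [set y | A y /\ f y = phi].
apply: (@sub_finite_set _ _ (g @` setT)); last first.
  exact/finite_image/finite_finset.
move=> y Ay; exists (f y) => //; rewrite /g.
case: xgetP => [z _ [Az fz]|/(_ y)[]//]; exact: f_inj.
Qed.

End DualLattice.

(** * Finite convex hulls, separation and exposed points *)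

Section Convexity.
Variables (R : realType) (d : nat).
Implicit Types (x y z u p q : 'rV[R]_d) (C : set 'rV[R]_d) (s : seq 'rV[R]_d).

(* The qualified name is needed: [convex_set] is also a constant of
   mathcomp-analysis. *)
Lemma convex_sum C n (l : 'I_n -> R) (v : 'I_n -> 'rV[R]_d) : Defs.convex_set C ->
  (forall i, 0 <= l i) -> \sum_i l i = 1 -> (forall i, C (v i)) ->
  C (\sum_i l i *: v i).
Proof.
move=> cvxC; elim: n l v => [|n IH] l v l0 l1 Cv.
  by move: l1; rewrite big_ord0 => /esym/eqP; rewrite oner_eq0.
move: l1; rewrite !big_ord_recl /=; set t := \sum_(i < n) _ => l1.
have t0 : 0 <= t by exact: sumr_ge0.
have [tz|tnz] := eqVneq t 0.
  rewrite [X in _ + X]big1 ?addr0 => [|i _].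
    by move: l1; rewrite tz addr0 => ->; rewrite scale1r.
  by rewrite (psumr_eq0P _ tz) ?scale0r.
rewrite (_ : \sum_(i < n) _ =
    t *: \sum_(i < n) (l (lift ord0 i) / t) *: v (lift ord0 i)); last first.
  rewrite scaler_sumr; apply: eq_bigr => i _.
  by rewrite scalerA mulrC divfK.
rewrite (_ : l ord0 = 1 - t); last by lra.
apply: cvxC => //; last by have := l0 ord0; lra.
apply: IH => // [i|]; first by rewrite divr_ge0.
by rewrite -mulr_suml divff.
Qed.

Lemma conv_seq_sub C s : Defs.convex_set C -> (forall x, x \in s -> C x) ->
  conv_seq s `<=` C.
Proof.
move=> cvxC sC x [l [l0 l1 ->]]; apply: convex_sum => // i.
exact/sC/mem_nth.
Qed.

Lemma compact_simplex n :
  compact [set l : 'rV[R]_n | (forall i, 0 <= l 0 i) /\ \sum_i l 0 i = 1].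
Proof.
rewrite (_ : mkset _ = [set l : 'rV[R]_n | forall i, `[0%R, 1%R]%classic (l 0 i)] `&`
    [set l : 'rV[R]_n | \sum_i l 0 i = 1]).
  apply: compact_closedI.
    have := @rV_compact R n (fun=> `[0%R, 1%R]%classic).
    by apply => i; exact: segment_compact.
  apply: (@preimage_closed _ _ (fun l : 'rV[R]_n => \sum_i l 0 i) [set 1]).
    move=> l _; apply: (@continuous_sumr R _ _ _ (fun i (l : 'rV[R]_n) => l 0 i)).
    by move=> i; exact: coord_continuous.
  exact: closed_eq.
apply/seteqP; split => l /= [l0 l1]; split => // i.
  rewrite in_itv /= l0 /= -l1 (bigD1 i) //= lerDl.
  by apply: sumr_ge0.
by have := l0 i; rewrite in_itv /= => /andP[].
Qed.

(** The separating direction is [x - p], with [p] the point of the hull nearest to [x]; it exists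
    because the hull is the image of a compact simplex. *)
Lemma conv_seq_separation s x : ~ conv_seq s x ->
  exists u, forall p, p \in s -> dotv u p < dotv u x.
Proof.
move=> nsx; have [->|sn0] := eqVneq s [::]; first by exists 0.
have s0 : (0 < size s)%N by rewrite lt0n size_eq0.
pose pt (l : 'rV[R]_(size s)) := \sum_i l 0 i *: s`_i.
pose Delta : set 'rV[R]_(size s) :=
  [set l | (forall i, 0 <= l 0 i) /\ \sum_i l 0 i = 1].
have Dd k : Delta (delta_mx 0 k).
  split=> [i|]; first by rewrite mxE; case: (_ && _).
  rewrite (bigD1 k) //= big1 => [|i /negPf ik]; rewrite mxE ?eqxx ?addr0 //.
  by rewrite ik andbF.
have D0 : Delta !=set0 by exists (delta_mx 0 (Ordinal s0)).
have cf : continuous (fun l => dotv (pt l - x) (pt l - x)).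
  apply: continuous_sumr => j l.
  have h : {for l, continuous (fun l => (pt l - x) 0 j)}.
    rewrite (_ : (fun l => _) =
        (fun l : 'rV[R]_(size s) => (\sum_i l 0 i * s`_i 0 j) - x 0 j)).
      have cs : continuous (fun l : 'rV[R]_(size s) => \sum_i l 0 i * s`_i 0 j).
        apply: continuous_sumr => i {}l.
        by apply: continuousM; [exact: coord_continuous|exact: cst_continuous].
      by apply: continuousB; [exact: cs|exact: cst_continuous].
    apply/funext => {}l; rewrite !mxE summxE; congr (_ - _).
    by apply: eq_bigr => i _; rewrite mxE.
  exact: continuousM.
have [l [l0 l1] lmin] := compact_argmin (@compact_simplex _) D0 cf.
set p := pt l in lmin.
have px : p != x.
  by apply/eqP => px; apply: nsx; exists (fun i => l 0 i); split.
exists (x - p) => _ /(nthP 0)[k ks <-]; set q := s`_k.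
pose b := dotv (q - p) (q - p); pose a := dotv (q - p) (p - x).
(* Moving from [p] towards [q] by [t] changes the squared distance to [x] by [t * (2 * a + t * b)],
   which cannot be negative. *)
have ab t : 0 <= t -> t <= 1 -> 0 <= t * (2 * a + t * b).
  move=> t0 t1.
  have Dt : Delta ((1 - t) *: l + t *: delta_mx 0 (Ordinal ks)).
    have [d0 d1] := Dd (Ordinal ks); split=> [i|].
      by have := l0 i; have := d0 i; rewrite !mxE; nra.
    under eq_bigr do rewrite mxE [X in X + _]mxE [X in _ + X]mxE.
    by rewrite big_split -!mulr_sumr /= l1 d1; lra.
  have ptt : pt ((1 - t) *: l + t *: delta_mx 0 (Ordinal ks)) =
             (1 - t) *: p + t *: q.
    rewrite /p /pt !scaler_sumr.
    rewrite (_ : t *: q = \sum_i (t * (delta_mx 0 (Ordinal ks) : 'rV[R]__) 0 i) *: s`_i).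
      rewrite -big_split; apply: eq_bigr => i _ /=.
      by rewrite !mxE scalerA -scalerDl.
    rewrite (bigD1 (Ordinal ks)) //= big1 => [|i /negPf ik].
      by rewrite mxE !eqxx mulr1 addr0.
    by rewrite mxE ik andbF mulr0 scale0r.
  have := lmin _ Dt; rewrite ptt /a /b.
  rewrite !(dotvBl, dotvBr, dotvDl, dotvDr, dotvZl, dotvZr).
  by rewrite (dotvC p x) (dotvC q x) (dotvC q p); nra.
have b0 : 0 <= b by exact: dotvv_ge0.
have a0 : 0 <= a.
  rewrite leNgt; apply/negP => a0.
  have ba : 0 < b - a by lra.
  (* For this [t], [t * b <= - a], so [2 * a + t * b <= a < 0]. *)
  have t0 : 0 < - a / (b - a) by rewrite divr_gt0 ?oppr_gt0.
  have t1 : - a / (b - a) <= 1 by rewrite ler_pdivrMr //; lra.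
  have := ab _ (ltW t0) t1; rewrite pmulr_rge0 // => h.
  have : - a / (b - a) * b <= - a by rewrite mulrAC ler_pdivrMr //; nra.
  by lra.
(* Now [a0] says that [x - p] is no larger at [q] than at [p], and it is strictly larger at [x]. *)
have : 0 < dotv (x - p) (x - p) by rewrite dotvv_gt0 subr_eq0 eq_sym.
move: a0; rewrite /a !(dotvBl, dotvBr) (dotvC p x) (dotvC q x) (dotvC q p).
by lra.
Qed.

(** Exposed points, with the exposing functional kept explicit: the question is whether a width
    direction can take that role. *)
Definition unique_max C u p :=
  C p /\ forall q, C q -> q != p -> dotv u q < dotv u p.

(** Expanding around [p], the squared distance from [z] to [q] exceeds that to [p] by [2 * dotv (p -
    z) (q - p) + dotv (q - p) (q - p)], and the last term is positive for [q != p]. *)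
Lemma farthest_unique_max C z : compact C -> C !=set0 ->
  exists p, unique_max C (p - z) p /\
    forall q, C q -> dotv (q - z) (q - z) <= dotv (p - z) (p - z).
Proof.
move=> cC C0.
have [p Cp pm] := compact_argmax cC C0 (@sqdist_continuous _ _ z).
exists p; split=> //; split=> // q Cq qp.
have : 0 < dotv (q - p) (q - p) by rewrite dotvv_gt0 subr_eq0.
have := pm q Cq.
rewrite !(dotvBl, dotvBr) (dotvC q p) (dotvC q z) (dotvC p z).
by lra.
Qed.

(* Straszewicz's argument: the ball through a point [x] outside [conv_seq s]
   and centred far away on the other side of a separating hyperplane contains
   [s] in its interior, so a point of [C] farthest from the centre is exposed
   but not in [s]. *)
Lemma conv_seq_exposed C s : Defs.convex_set C -> compact C ->
  (forall p, p \in s -> C p) -> (forall u p, unique_max C u p -> p \in s) ->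
  C = conv_seq s.
Proof.
move=> cvxC cC sC Cs; apply/seteqP; split; last exact: conv_seq_sub.
move=> x Cx; apply: contrapT => /conv_seq_separation[u us].
have [t tP] : exists t, forall p, p \in s ->
    dotv (p + t *: u) (p + t *: u) < dotv (x + t *: u) (x + t *: u).
  (* Asking for all [t] beyond a threshold lets the induction on [s] add thresholds. *)
  have [t _ tP] : exists2 t0, 0 <= t0 & forall p t, p \in s -> t0 <= t ->
      dotv (p + t *: u) (p + t *: u) < dotv (x + t *: u) (x + t *: u).
    elim: s us {sC Cs} => [|p s IH] us; first by exists 0.
    have [q qs|t0 t00 IHt] := IH; first by apply: us; rewrite inE qs orbT.
    have upx : 0 < dotv u x - dotv u p by rewrite subr_gt0 us ?mem_head.
    (* The gap between the squared norms contains [2 * t * (dotv u x - dotv u p)], which must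
       outweigh [dotv p p]; the [1] makes it strict. *)
    pose t1 := (1 + dotv p p) / (dotv u x - dotv u p).
    have t10 : 0 <= t1.
      by rewrite divr_ge0 ?(ltW upx) // addr_ge0 // dotvv_ge0.
    exists (t0 + t1) => [|q t]; first exact: addr_ge0.
    rewrite inE => /predU1P[->|qs] tt; last by apply: IHt => //; lra.
    have : (1 + dotv p p) <= t * (dotv u x - dotv u p).
      by rewrite -ler_pdivrMr // -/t1; lra.
    have := dotvv_ge0 x; have := dotvv_ge0 p.
    rewrite !(dotvDl, dotvDr, dotvZl, dotvZr) (dotvC p u) (dotvC x u).
    by nra.
  by exists t => p ps; exact: tP.
have [|p [pmax pfar]] := farthest_unique_max (- t *: u) cC; first by exists x.
have := tP p (Cs _ _ pmax); have := pfar x Cx.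
by rewrite scaleNr !opprK; lra.
Qed.

End Convexity.

(** * Exposed points of lattice reduced bodies *)

Section Reduced.
Variables (R : realType) (d : nat) (L C : set 'rV[R]_d).
Implicit Types (x y z u p q : 'rV[R]_d).
Local Notation M := (dual_lattice L).
Local Notation w := (lattice_width L C).

Hypothesis fullL :
  forall V : {vspace 'rV[R]_d}, (forall x, L x -> x \in V) -> V = fullv.
Hypothesis bodyC : convex_body C.

Let cvxC : Defs.convex_set C. Proof. by case: bodyC. Qed.
Let cptC : compact C. Proof. by case: bodyC. Qed.
Let neC : C !=set0.
Proof. by case: bodyC => _ _ [x /interior_subset Cx]; exists x. Qed.

Lemma body_ball : exists x (e : R), 0 < e /\ ball x e `<=` C.
Proof.
have [_ _ [x]] := bodyC; rewrite /interior /= => /nbhs_ballP[e /= e0 xeC].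
by exists x, e.
Qed.

Lemma width_gt0 y : y != 0 -> 0 < width_along C y.
Proof.
move=> y0; have [x [e [e0 xeC]]] := body_ball.
have [i yi] : exists i, y 0 i != 0.
  apply: contrapT => ny; move/eqP: y0; apply; apply/rowP => i.
  by rewrite mxE; apply: contrapT => yi; apply: ny; exists i; exact/eqP.
apply: lt_le_trans (width_ge_coord y i cptC e0 xeC).
by rewrite mulr_gt0 // normr_gt0.
Qed.

Lemma bounded_width_finite (B : R) :
  finite_set [set y | M y /\ width_along C y <= B].
Proof.
have [x [e [e0 xeC]]] := body_ball.
apply: sub_finite_set (dual_bounded_finite fullL (B / e)) => y /= [My yB].
split=> // i; rewrite ler_pdivlMr // mulrC.
exact: le_trans (width_ge_coord y i cptC e0 xeC) yB.
Qed.

Lemma lattice_width_ge0 y : M y -> y != 0 -> 0 <= w.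
Proof.
move=> My y0; apply: lb_le_inf; first by exists (width_along C y), y.
by move=> _ [z [_ _ ->]]; exact: width_ge0.
Qed.

Lemma width_directionN y :
  width_direction L C y -> width_direction L C (- y).
Proof.
by case=> My y0 yw; split; rewrite ?oppr_eq0 ?width_opp //; exact: dualN.
Qed.

Lemma not_unique_max y p : C p -> ~ unique_max C y p ->
  exists2 a, C a & a != p /\ forall q, C q -> dotv y q <= dotv y a.
Proof.
move=> Cp nyp.
have [q Cq [qp yq]] : exists2 q, C q & q != p /\ dotv y p <= dotv y q.
  apply: contrapT => nq; apply: nyp; split=> // q Cq qp; rewrite ltNge.
  by apply/negP => yq; apply: nq; exists q.
have [a Ca am] := compact_argmax cptC neC (@dotv_continuous _ _ y).
have [ap|ap] := eqVneq a p; last by exists a.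
by exists q => //; split=> // r Cr; apply: le_trans (am r Cr) _; rewrite ap.
Qed.

(* If no width direction is maximized at [p] only, then cutting off a small
   cap at the exposed point [p] loses none of the width in any direction. *)
Lemma exposed_width_chord u p y : unique_max C u p ->
  (forall z, width_direction L C z -> ~ unique_max C z p) ->
  M y -> y != 0 ->
  exists a b, [/\ C a, C b, dotv u a < dotv u p, dotv u b < dotv u p &
    w <= dotv y (a - b)].
Proof.
move=> [Cp up] nw My y0.
(* Along a width direction, both [y] and [- y] attain their maximum away from [p], and these two
   maximizers span the full width. *)
have [yw|yw] := eqVneq (width_along C y) w.
  have wy : width_direction L C y by split.
  have [a Ca [ap am]] := not_unique_max Cp (nw _ wy).
  have [b Cb [bp bm]] := not_unique_max Cp (nw _ (width_directionN wy)).
  exists a, b; split; [exact: Ca|exact: Cb|exact: up|exact: up|].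
  have [a' [b' [Ca' Cb' e]]] := width_attained y cptC neC.
  rewrite -yw e; have := am _ Ca'; have := bm _ Cb'.
  by rewrite !dotvNl !dotvBr; lra.
have yw' : w < width_along C y by rewrite lt_def yw lattice_width_le.
have w0 := lattice_width_ge0 My y0.
have [q Cq qp] : exists2 q, C q & q != p.
  apply: contrapT => nq.
  have [a [b [Ca Cb e]]] := width_attained y cptC neC.
  have := width_gt0 y0; rewrite e.
  have Cp1 q : C q -> q = p.
    by move=> Cq; apply/eqP; apply: contrapT => /negP qp; apply: nq; exists q.
  by rewrite (Cp1 a Ca) (Cp1 b Cb) dotvBr subrr ltxx.
have uq := up q Cq qp.
have [a [b [Ca Cb e]]] := width_attained y cptC neC.
set W := width_along C y in yw' e.
(* Contracting a widest chord towards [q] with ratio [w / W] leaves width exactly [w]; the positive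
   weight [t] of [q] brings both ends strictly below [p] along [u]. *)
pose t := 1 - w / W.
have W0 : 0 < W by exact: width_gt0.
have wW : w / W < 1 by rewrite ltr_pdivrMr ?mul1r.
have wW0 : 0 <= w / W by rewrite divr_ge0 // ltW.
have t0 : 0 < t by rewrite subr_gt0.
have t1 : t <= 1 by rewrite /t; lra.
have ua r : C r -> dotv u ((1 - t) *: r + t *: q) < dotv u p.
  move=> Cr; rewrite dotvDr !dotvZr.
  have : dotv u r <= dotv u p.
    by have [->//|rp] := eqVneq r p; exact/ltW/up.
  by nra.
exists ((1 - t) *: a + t *: q), ((1 - t) *: b + t *: q).
split; [apply: cvxC => //; exact: ltW|apply: cvxC => //; exact: ltW|
        exact: ua|exact: ua|].
have : (1 - t) * W = w by rewrite /t opprB addrC subrK divfK // gt_eqF.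
by rewrite e !dotvBr !dotvDr !dotvZr; lra.
Qed.

(** Otherwise cutting [C] along a level of [u] just below [p] would give a smaller convex body of
    the same lattice width. *)
Lemma exposed_width_direction u p : (0 < d)%N -> lattice_reduced L C ->
  unique_max C u p -> exists2 y, width_direction L C y & unique_max C y p.
Proof.
move=> d0 redC upm; have [Cp up] := upm.
apply: contrapT => nw.
have {}nw z : width_direction L C z -> ~ unique_max C z p.
  by move=> zw zp; apply: nw; exists z.
have [x [e0 [e00 xe0C]]] := body_ball.
(* The centre [x] is not [p]: [u] would be strictly smaller at two points of the ball whose midpoint
   is [x]. *)
have ux : dotv u x < dotv u p.
  have Cx : C x by apply: xe0C; exact: ballxx.
  apply: (up) => //; apply/eqP => xp.
  have h : `|e0 / 2| < e0 by rewrite gtr0_norm; lra.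
  have h' : `|- (e0 / 2)| < e0 by rewrite normrN.
  pose i := Ordinal d0.
  have ne r : r != 0 -> x + r *: delta_mx 0 i != p.
    move=> r0; rewrite -xp -subr_eq0 addrAC subrr add0r.
    apply/eqP => /rowP/(_ i); rewrite !mxE !eqxx mulr1 => /eqP.
    by rewrite (negPf r0).
  have e2 : e0 / 2 != 0 by lra.
  have e2' : - (e0 / 2) != 0 by lra.
  have := up _ (xe0C _ (ball_delta x i e00 h)) (ne _ e2).
  have := up _ (xe0C _ (ball_delta x i e00 h')) (ne _ e2').
  by rewrite -xp !dotvDr !dotvZr; lra.
(* Every cut at a level at least [c0] keeps a fixed ball around [x]. *)
pose c0 := (dotv u x + dotv u p) / 2.
have [e [e1 xeC]] : exists e : R, 0 < e /\
    ball x e `<=` C `&` [set z | dotv u z <= c0].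
  suff : nbhs x (C `&` [set z | dotv u z <= c0]).
    by move=> /nbhs_ballP[e /= e1 xeC]; exists e.
  apply: filterI; first by apply/nbhs_ballP; exists e0.
  have uxc : dotv u x < c0 by rewrite /c0; lra.
  have : nbhs x (dotv u @^-1` [set r | r < c0]).
    by apply: dotv_continuous; exact: lt_nbhsl.
  by apply: filterS => z; exact: ltW.
(* A dual vector with a coordinate above [w / e] in absolute value has width above [w] on the kept
   ball alone, so only finitely many vectors need a chord that survives the cut. *)
have /finite_seqP[ys ysP] := dual_bounded_finite fullL (w / e).
have [c [c0c cp chord]] : exists c, [/\ c0 <= c, c < dotv u p &
    forall y, y \in ys -> M y -> y != 0 -> exists a b,
      [/\ C a, C b, dotv u a <= c, dotv u b <= c & w <= dotv y (a - b)]].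
  elim: ys {ysP} => [|y ys [c [c0c cp IH]]].
    by exists c0; split=> //; rewrite /c0; lra.
  have [[My y0]|ny] := pselect (M y /\ y != 0); last first.
    exists c; split=> // z; rewrite inE => /predU1P[->|zys]; last exact: IH.
    by move=> My y0; case: ny.
  have [a [b [Ca Cb ua ub wab]]] := exposed_width_chord upm nw My y0.
  exists (Num.max c (Num.max (dotv u a) (dotv u b))); split.
  - by rewrite le_max c0c.
  - by rewrite !gt_max cp ua ub.
  move=> z; rewrite inE => /predU1P[->|zys] Mz z0.
    by exists a, b; split=> //; rewrite !le_max lexx !orbT.
  have [a' [b' [Ca' Cb' ua' ub' wab']]] := IH z zys Mz z0.
  by exists a', b'; split=> //; rewrite le_max ?ua' ?ub'.
pose C' := C `&` [set z | dotv u z <= c].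
have C'C : C' `<=` C by move=> z [].
have cptC' : compact C'.
  apply: compact_closedI => //.
  apply: (@preimage_closed _ _ (dotv u) [set r | r <= c]).
    by move=> z _; exact: dotv_continuous.
  exact: closed_le.
have xC' : ball x e `<=` C'.
  by move=> z /xeC[Cz uz]; split=> //=; exact: le_trans c0c.
have neC' : C' !=set0 by exists x; apply: xC'; exact: ballxx.
apply: (redC C') => //.
- split=> //; last first.
    by exists x; rewrite /interior /=; apply/nbhs_ballP; exists e.
  move=> a b t [Ca uca] [Cb ucb] t0 t1; split; first exact: cvxC.
  by move: uca ucb => /=; rewrite dotvDr !dotvZr; nra.
- by move=> C'eC; move: Cp; rewrite -C'eC => -[_] /=; rewrite leNgt cp.
(* Without nonzero dual vectors both lattice widths are the infimum of the empty set. *)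
have [[y0 [My0 y00]]|nM] := pselect (exists y, M y /\ y != 0); last first.
  rewrite /lattice_width; congr inf; apply/seteqP.
  by split=> r [y [My y0 _]]; case: nM; exists y.
apply/eqP; rewrite eq_le; apply/andP; split.
  apply: lb_le_inf; first by exists (width_along C y0), y0.
  move=> _ [y [My yn0 ->]]; apply: le_trans (width_mono y cptC cptC' neC' C'C).
  exact: lattice_width_le.
apply: lb_le_inf; first by exists (width_along C' y0), y0.
move=> _ [y [My yn0 ->]].
have [yB|] := pselect (forall i, `|y 0 i| <= w / e).
  have [|a [b [Ca Cb ua ub wab]]] := chord y _ My yn0.
    by have : [set` ys] y by rewrite -ysP.
  exact: le_trans wab (le_width _ cptC' _ _).
move=> /existsNP[i /negP]; rewrite -ltNge ltr_pdivrMr // mulrC => wy.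
exact: le_trans (ltW wy) (width_ge_coord y i cptC' e1 xC').
Qed.

End Reduced.

(** * Classes of dual vectors modulo 2 *)

Section Parity.
Variables (R : realType) (d : nat) (L : set 'rV[R]_d).
Local Notation M := (dual_lattice L).

Hypothesis fullL :
  forall V : {vspace 'rV[R]_d}, (forall x, L x -> x \in V) -> V = fullv.

(* The classes modulo 2 of the group generated by the [ws i] are encoded by
   subsets of a set [S] indexing the nonzero diagonal entries of the Smith
   normal form of the coordinates of the [ws i]. *)
Lemma parity_classes m (ws : 'I_m -> 'rV[R]_d) (U : {vspace 'rV[R]_d}) :
  (forall i, M (ws i)) -> (forall i, ws i \in U) ->
  exists (S : {set 'I_m}) (cls : 'I_m -> {set 'I_m}),
    [/\ (#|S| <= \dim U)%N, forall i, cls i \subset S,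
      forall i j, cls i = cls j -> exists2 g, M g & ws i = ws j + 2 *: g &
      forall i, cls i = finset.set0 -> exists2 g, M g & ws i = 2 *: g].
Proof.
move=> wsM wsU; have [X XL Xf] := spanning_seq fullL.
pose A : 'M[int]_(m, size X) := \matrix_(i, j) Num.floor (dotv (ws i) X`_j).
have AE i j : (A i j)%:~R = dotv (ws i) X`_j.
  rewrite mxE; apply/eqP; rewrite -intrEfloor dotvC.
  by apply: wsM; apply/XL/mem_nth.
have [P Pu [Q Qu [dd _ Adec]]] := int_Smith_normal_form A.
set D := \matrix_(i, j) _ in Adec.
have D_diag k l : D k l != 0 -> k = l :> nat.
  by rewrite mxE; case: (k =P l :> nat) => // _; rewrite mulr0n eqxx.
(* Since [P] is invertible over the integers, [v] generates the same group as [ws]; its pairings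
   with [X] form [D *m Q]. *)
pose v k := \sum_i (invmx P k i)%:~R *: ws i.
have vM k : M (v k) by apply: dual_sum => i _; exact: dualZ.
have vU k : v k \in U by apply: memv_suml => i _; rewrite memvZ.
have wsE i : ws i = \sum_k (P i k)%:~R *: v k.
  under eq_bigr do rewrite scaler_sumr.
  rewrite exchange_big /= (bigD1 i) //= [X in _ + X]big1 ?addr0 => [|j ji].
    under eq_bigr do rewrite scalerA -rmorphM.
    have := congr1 (fun N : 'M[int]_m => N i i) (mulmxV Pu).
    rewrite !mxE eqxx -scaler_suml -rmorph_sum /= => ->.
    by rewrite scale1r.
  under eq_bigr do rewrite scalerA -rmorphM.
  have := congr1 (fun N : 'M[int]_m => N i j) (mulmxV Pu).
  rewrite !mxE eq_sym (negPf ji) -scaler_suml -rmorph_sum /= => ->.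
  by rewrite scale0r.
have vX k (j : 'I_(size X)) : dotv (v k) X`_j = ((D *m Q) k j)%:~R.
  have -> : D *m Q = invmx P *m A by rewrite Adec -mulmxA mulKmx.
  rewrite dotv_suml [in RHS]mxE rmorph_sum; apply: eq_bigr => i _ /=.
  by rewrite dotvZl rmorphM /= AE.
(* Undoing [Q] as well makes the pairings of [v] with [Y] diagonal, so the [v k] with [k] in [S]
   will be linearly independent. *)
pose Y l := \sum_j (invmx Q j l)%:~R *: X`_j.
have vY k l : dotv (v k) (Y l) = (D k l)%:~R.
  have -> : D = D *m Q *m invmx Q by rewrite mulmxK.
  rewrite dotv_sumr [in RHS]mxE rmorph_sum; apply: eq_bigr => j _ /=.
  by rewrite dotvZr vX rmorphM /= mulrC.
pose S := [set k | [exists l, D k l != 0]]%SET.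
have vS k : k \notin S -> v k = 0.
  rewrite inE => /existsPn Dk; apply: (dotv_span_eq0 Xf) => x xX.
  have xi : (index x X < size X)%N by rewrite index_mem.
  have := vX k (Ordinal xi); rewrite /= nth_index // => ->.
  rewrite mxE big1 // => l _.
  by move: (Dk l); rewrite negbK => /eqP ->; rewrite mul0r.
(* The class of [ws i] records the parities of its coordinates along [v]; those outside [S] multiply
   zero vectors. *)
exists S, (fun i => [set k in S | odd `|P i k|]%SET).
have half (c : 'I_m -> int) : (forall k, k \in S -> ~~ odd `|c k|) ->
    exists2 g, M g & \sum_k (c k)%:~R *: v k = 2 *: g.
  move=> ev; exists (\sum_(k in S) (c k %/ 2)%Z%:~R *: v k).
    by apply: dual_sum => k _; exact: dualZ.
  rewrite (bigID (mem S)) /= [X in _ + X]big1 ?addr0 => [|k kS].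
    rewrite scaler_sumr; apply: eq_bigr => k kS; rewrite scalerA.
    rewrite -[2]/(2%:~R) -rmorphM /=; congr (_%:~R *: _).
    by have := ev k kS; lia.
  by rewrite vS // scaler0.
split.
- pose t := [tuple v (enum_val k) | k < #|S|].
  have tE (k : 'I_#|S|) : t`_k = v (enum_val k).
    by rewrite -tnth_nth tnth_mktuple.
  have tfree : free t.
    apply/freeP => c c0 k.
    have kS := enum_valP k; move: (kS); rewrite inE => /existsP[l Dl].
    have := congr1 (fun x => dotv x (Y l)) c0.
    rewrite dot0v dotv_suml (bigD1 k) // big1 => [|k' k'k].
      rewrite dotvZl tE vY /= addr0 => /eqP.
      by rewrite mulf_eq0 intr_eq0 (negPf Dl) orbF => /eqP.
    rewrite dotvZl tE vY.
    have [->|Dl'] := eqVneq (D (enum_val k') l) 0; first by rewrite mulr0.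
    move: k'k.
    have /val_inj/enum_val_inj -> : val (enum_val k') = val (enum_val k).
      by rewrite /= (D_diag _ _ Dl) (D_diag _ _ Dl').
    by rewrite eqxx.
  have -> : #|S| = size t by rewrite size_tuple.
  rewrite -(eqP tfree); apply/dimvS/span_subvP => x /tnthP[k ->].
  by rewrite tnth_mktuple.
- by move=> i; apply/fintype.subsetP => k; rewrite inE => /andP[].
- move=> i j /finset.setP cij.
  have [k kS|g Mg gE] := half (fun k => P i k - P j k).
    by have := cij k; rewrite !inE; move: kS; rewrite inE => ->; lia.
  exists g => //; rewrite -gE [in LHS]wsE [in RHS]wsE -big_split.
  by apply: eq_bigr => k _ /=; rewrite -scalerDl -rmorphD addrC subrK.
- move=> i /finset.setP ci0.
  have [k kS|g Mg gE] := half (P i); last by exists g => //; rewrite wsE.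
  by have := ci0 k; rewrite !inE; move: kS; rewrite inE => -> /= ->.
Qed.

End Parity.

(** * Counting width directions that have a unique maximizer *)

Section WidthClasses.
Variables (R : realType) (d : nat) (L C : set 'rV[R]_d).
Implicit Types (x y z p g : 'rV[R]_d).
Local Notation M := (dual_lattice L).
Local Notation w := (lattice_width L C).

Hypothesis bodyC : convex_body C.

Let cptC : compact C. Proof. by case: bodyC. Qed.
Let neC : C !=set0.
Proof. by case: bodyC => _ _ [x /interior_subset Cx]; exists x. Qed.

Lemma width_direction_gt0 y : width_direction L C y -> 0 < w.
Proof. by case=> _ y0 <-; exact: width_gt0. Qed.

Lemma le_width_direction y a b : width_direction L C y -> C a -> C b ->
  dotv y (a - b) <= w.
Proof. by case=> _ _ <- Ca Cb; exact: le_width. Qed.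

Lemma width_chord g : M g -> g != 0 ->
  exists a b, [/\ C a, C b & w <= dotv g (a - b)].
Proof.
move=> Mg g0; have [a [b [Ca Cb e]]] := width_attained g cptC neC.
by exists a, b; split=> //; rewrite -e lattice_width_le.
Qed.

(** Otherwise [g] would be a nonzero dual vector with half the positive minimal width. *)
Lemma width_direction_not_even y g : width_direction L C y -> M g ->
  y <> 2 *: g.
Proof.
move=> wy Mg yg.
have g0 : g != 0.
  by case: wy => _ + _; rewrite yg; apply: contra => /eqP ->; rewrite scaler0.
have [a [b [Ca Cb]]] := width_chord Mg g0.
have := le_width_direction wy Ca Cb; have := width_direction_gt0 wy.
by rewrite yg dotvZl; lra.
Qed.

(* If [y <> z] and [y <> - z], then [(y - z) / 2] and [(y + z) / 2] are nonzero
   dual vectors, so the width is attained along both; this puts [p] both in the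
   face maximizing [z] and in the face minimizing [z]. *)
Lemma width_direction_same_parity y z p g : width_direction L C y ->
  width_direction L C z -> unique_max C y p -> M g -> y = z + 2 *: g ->
  y = z \/ y = - z.
Proof.
move=> wy wz [Cp yp] Mg yE.
have [g0|g0] := eqVneq g 0; first by left; rewrite yE g0 scaler0 addr0.
have [h0|h0] := eqVneq (z + g) 0.
  have gE : g = - z by apply/eqP; rewrite -addr_eq0 addrC h0.
  by right; rewrite yE gE scaler_nat mulr2n addrA subrr add0r.
have Mh : M (z + g) by apply: dualD => //; case: wz.
have ymax a b : C a -> C b -> dotv y (a - b) = w -> a = p.
  move=> Ca Cb ab; apply/eqP; apply: contrapT => /negP ap.
  have := yp a Ca ap; have := le_width_direction wy Cp Cb.
  by rewrite -ab !dotvBr; lra.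
have [a [b [Ca Cb]]] := width_chord Mg g0.
have [a' [b' [Ca' Cb']]] := width_chord Mh h0.
have gE x : dotv g x = (dotv y x - dotv z x) / 2.
  by rewrite yE dotvDl dotvZl; lra.
rewrite dotvDl !gE => h1 h2.
have y1 := le_width_direction wy Ca Cb.
have y2 := le_width_direction wy Ca' Cb'.
have z1 := le_width_direction wz Cb Ca.
have z2 := le_width_direction wz Ca' Cb'.
have zN : dotv z (a - b) = - dotv z (b - a) by rewrite -dotvNr opprB.
have ap : a = p by apply: (ymax a b) => //; lra.
have ap' : a' = p by apply: (ymax a' b') => //; lra.
have zb : dotv z (b - a) = w by lra.
have zb' : dotv z (a' - b') = w by lra.
suff : w <= 0 by rewrite leNgt (width_direction_gt0 wy).
move: zb zb' (le_width_direction wz Cb Cb').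
by rewrite ap ap' !dotvBr; lra.
Qed.

Hypothesis fullL :
  forall V : {vspace 'rV[R]_d}, (forall x, L x -> x \in V) -> V = fullv.

(** A class modulo 2 meets [T] in at most one direction and its opposite, and the zero class is
    never met. *)
Lemma card_unique_max m (ws : 'I_m -> 'rV[R]_d) (U : {vspace 'rV[R]_d})
    (T : {set 'I_m}) : injective ws ->
  (forall i, width_direction L C (ws i)) -> (forall i, ws i \in U) ->
  (forall i, i \in T -> exists p, unique_max C (ws i) p) ->
  (#|T| <= 2 ^ (\dim U).+1 - 2)%N.
Proof.
move=> ws_inj wsW wsU Tp.
have wsM i : M (ws i) by case: (wsW i).
have [S [cls [Sk clsS clsE cls0]]] := parity_classes fullL wsM wsU.
have fiber i : i \in T -> (#|[set j in T | cls j == cls i]%SET| <= 2)%N.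
  move=> iT; pose F := [set j | ws j == - ws i]%SET.
  have F1 : (#|F| <= 1)%N.
    apply/card_le1_eqP => j k; rewrite !inE => /eqP jE /eqP kE.
    by apply: ws_inj; rewrite jE kE.
  apply: (@leq_trans #|i |: F|%SET).
    apply/subset_leq_card/fintype.subsetP => j; rewrite !inE => /andP[jT /eqP cE].
    have [g Mg gE] := clsE _ _ cE; have [p jp] := Tp j jT.
    have [/ws_inj ->|->] :=
      width_direction_same_parity (wsW j) (wsW i) jp Mg gE.
      by rewrite eqxx.
    by rewrite eqxx orbT.
  by rewrite cardsU1 (leq_add (leq_b1 _) F1).
(* There are [2 ^ #|S| - 1] nonempty classes, and two indices for each give the bound. *)
pose N := (powerset S :\ finset.set0)%SET.
rewrite -sum1_card (partition_big cls (mem N)) /=.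
  apply: (@leq_trans (\sum_(c in N) 2)).
    apply: leq_sum => c _; rewrite sum1_card.
    have [i /andP[iT /eqP <-]|none] := pickP [pred i in T | cls i == c].
      by apply: leq_trans (fiber i iT); rewrite cardsE.
    by rewrite (eq_card0 none).
  rewrite sum_nat_const; have := cardsD1 finset.set0 (powerset S).
  rewrite inE finset.sub0set card_powerset add1n -/N => cE.
  have : (2 ^ #|S| <= 2 ^ \dim U)%N by rewrite leq_exp2l.
  by rewrite expnS cE; lia.
move=> i iT; rewrite !inE clsS andbT; apply/eqP => ci0.
by have [g Mg] := cls0 i ci0; exact: width_direction_not_even.
Qed.

End WidthClasses.

(** * The vertex bound for lattice reduced bodies *)

Theorem theorem3p2 (R : realType) (d : nat) (L C : set 'rV[R]_d)
    (U : {vspace 'rV[R]_d}) :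
  (0 < d)%N ->
  is_lattice L ->
  convex_body C ->
  lattice_reduced L C ->
  span_of (width_direction L C) U ->
  polytope_at_most C (2 ^ (\dim U).+1 - 2).
Proof.
move=> d0 [_ _ _ fullL] bodyC redC [WU _].
have [cvxC cptC _] := bodyC.
have finW : finite_set (width_direction L C).
  apply: sub_finite_set (bounded_width_finite fullL bodyC (lattice_width L C)).
  by move=> y [My _ yw]; split; rewrite ?yw.
(* Duplicates are removed below so that the indexing [u] is injective, as the count requires. *)
have [ws wsW] := (finite_seqP _).1 finW.
pose us := undup ws; pose u (i : 'I_(size us)) := us`_i.
have uW i : width_direction L C (u i).
  by rewrite wsW /= -mem_undup mem_nth.
have u_inj : injective u.
  by move=> i j /eqP; rewrite nth_uniq ?undup_uniq // => /eqP/val_inj.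
(* The default [0] is discarded by restricting to [T], the indices for which a unique maximizer
   exists. *)
pose pt i := xget 0 [set p | unique_max C (u i) p].
pose T := [set i | `[< exists p, unique_max C (u i) p >]]%SET.
have ptP i : i \in T -> unique_max C (u i) (pt i).
  by rewrite inE => /asboolP[p up]; exact: (@xgetPex _ 0 _ (ex_intro _ p up)).
exists [seq pt i | i <- enum T]; split.
  rewrite size_map -cardE; apply: (card_unique_max bodyC fullL u_inj) => // i.
    exact: WU.
  by rewrite inE => /asboolP.
apply: conv_seq_exposed => //.
  by move=> p /mapP[i]; rewrite mem_enum => /ptP[? _] ->.
move=> v p vp; have [y yW yp] := exposed_width_direction fullL bodyC d0 redC vp.
have yu : y \in us by move: yW; rewrite wsW /= mem_undup.
pose i : 'I_(size us) := Ordinal (etrans (index_mem y us) yu).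
have ui : u i = y by rewrite /u /= nth_index.
have iT : i \in T by rewrite inE; apply/asboolP; exists p; rewrite ui.
apply/mapP; exists i; first by rewrite mem_enum.
have [_ im] := ptP i iT; apply/eqP; apply: contrapT => /negP pne.
have := im p yp.1 pne; have := yp.2 (pt i) (ptP i iT).1.
by rewrite eq_sym pne -ui => /(_ isT); lra.
Qed.
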